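(* Fix an integer $d\ge1$. For each $n$ let $V=(v_1,\ldots,v_n)$ be any labelled configuration of distinct points in $\mathbb{R}^d$, let $p=p(n)\in[0,1]$, and let $G\sim G(n,p)$. Then: (i) if $pn\to\infty$, then w.h.p. there is a reconstructable set $A\subseteq[n]$ with $|A|=n-o(n)$; (ii) if $pn\to0$, then w.h.p. every reconstructable set has size $o(n)$. The statements hold uniformly over $V$: in each case there are sequences $\varepsilon_n\to0$ and $\delta_n\to0$, which may depend on $d$ and on the function $p$ but not on $V$, such that for every $n$ and every $V$, with probability at least $1-\delta_n$, in case (i) there is a reconstructable set $A$ with $|A|\ge(1-\varepsilon_n)n$, and in case (ii) every reconstructable set has size at most $\varepsilon_n n$.
   Context: $[n]=\{1,\dots,n\}$ and $\mathrm{dist}$ is Euclidean distance. $G(n,p)$ is the random graph on $[n]$ in which each pair is an edge independently with probability $p$. Given a graph $G$ on $[n]$ and a labelled configuration $V=(v_1,\dots,v_n)$ of distinct points in $\mathbb{R}^d$, a set $A\subseteq[n]$ is reconstructable if every tuple $U=(u_1,\dots,u_n)$ of distinct points in $\mathbb{R}^d$ with $\mathrm{dist}(u_i,u_j)=\mathrm{dist}(v_i,v_j)$ for all edges $ij$ of $G$ satisfies $\mathrm{dist}(u_i,u_j)=\mathrm{dist}(v_i,v_j)$ for all $\{i,j\}\in\binom{A}{2}$. ''W.h.p.'' means with probability tending to $1$ as $n\to\infty$. *)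

(* Defs.v *)
From HB Require Import structures.
From mathcomp Require Import all_boot all_order all_algebra.
From mathcomp Require Import all_classical all_reals all_analysis.

Set Implicit Arguments.
Unset Strict Implicit.
Unset Printing Implicit Defensive.

Import Order.TTheory GRing.Theory Num.Theory numFieldNormedType.Exports.

Local Open Scope ring_scope.

(* The library norm on row vectors is the sup norm, hence this definition. *)
Definition eucl_dist (R : realType) (d : nat) (x y : 'rV[R]_d) : R :=
  Num.sqrt (\sum_(k < d) (x 0 k - y 0 k) ^+ 2).

(* A graph on n vertices is identified with its edge set, a subset of
   [vpairs n]; vertices i and j are adjacent when [set i; j] \in G. *)
Definition vpairs (n : nat) : {set {set 'I_n}} := [set e : {set 'I_n} | #|e| == 2%N]%SET.

(* Probability of the event E under G(n, p): each pair is independently an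
   edge with probability p. *)
Definition gnp_prob (R : realType) (n : nat) (p : R)
    (E : {set {set 'I_n}} -> Prop) : R :=
  \sum_(G in powerset (vpairs n) | `[< E G >])
    \prod_(e in vpairs n) (if e \in G then p else 1 - p).

Definition reconstructable (R : realType) (d n : nat) (G : {set {set 'I_n}})
    (v : 'I_n -> 'rV[R]_d) (A : {set 'I_n}) : Prop :=
  forall u : 'I_n -> 'rV[R]_d, injective u ->
    (forall i j : 'I_n, [set i; j]%SET \in G ->
       eucl_dist (u i) (u j) = eucl_dist (v i) (v j)) ->
    forall i j : 'I_n, i \in A -> j \in A -> i != j ->
      eucl_dist (u i) (u j) = eucl_dist (v i) (v j).

(* Main.v *)
Require Import Defs.
From HB Require Import structures.
From mathcomp Require Import all_boot all_order all_algebra.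
From mathcomp Require Import all_classical all_reals all_analysis.
From mathcomp Require Import ring lra.

(** Part (ii) is immediate: an isolated vertex can be moved far away without
    changing a revealed distance, so a reconstructable set with at least two
    elements consists of endpoints of edges
    ([reconstructable_no_isolated]), and the expected number of edges is at
    most [(p * n) * n].

    For part (i), say that a pair of vertices is in discord for a
    configuration [u] when [u] and [v] put its two vertices at different
    distances. The configuration [u] explains the graph [G] when its discord
    set misses [G]. Three ideas combine.

    No large discord set misses [G]. There are far too many discord sets, about
    [n ^ (d * n)], for a direct union bound. But if [D] misses [G], and [S] is
    a second random graph, then
    [P (G) = (1 - p) ^ #|D| * P (S :\: D = G)], and [S] together with the trace
    [D :&: S] determines [G]. Hence the probability that some discord set of
    size at least [t] misses [G] is at most [(1 - p) ^ t] times the expected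
    number of traces of discord sets on the sparse graph [S]
    ([subset_weight_avoid]). Discord sets are the non-vanishing patterns of
    quadratic polynomials in the [d * n] coordinates, so the linear independence
    argument of Ronyai, Babai and Ganapathy ([card_patterns_le]) bounds
    the number of traces by [C ^ n * (1 + y) ^ #|S|], where [y] is as small as
    desired and [C] depends on [d] and [y] only. The expectation of this bound
    is at most [C ^ n * exp (y * p * n ^ 2)], which is beaten by
    [(1 - p) ^ t] for [t = 2 * y * n ^ 2] once [p * n] is large.

    Displacements are small or large. Discard few vertices, so that each
    hyperplane either contains all remaining points or misses at least [g] of
    them, where [g] is a small multiple of [n] ([exists_robust]). If [u] has few
    discords, then an isometry makes [u] and [v] agree at all but [g / 4]
    of the remaining vertices ([small_displacement]). Conversely, if [w]
    differs from [v] exactly on a set [B] with [g / 4 < #|B| <= g / 2], then many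
    pairs not inside [B] are in discord, because the bisector of [w i] and
    [v i] does not contain [v i], hence misses many points
    ([large_displacement]).

    Gluing. One set must be reconstructed by all [u] at once. Moving
    the vertices of [B] as one explaining configuration does and the other
    vertices as a second one does gives a configuration that explains all
    edges not inside the union of the two displaced sets. The size of this
    union cannot lie between [g / 4] and [g / 2] by the two previous ideas, and
    it is at most [g / 2], so it is at most [g / 4]. Therefore a largest
    displaced set of size at most [g / 4] contains every other one, and the
    remaining vertices outside it form a reconstructable set
    ([exists_reconstructable]). *)

Set Implicit Arguments.
Unset Strict Implicit.
Unset Printing Implicit Defensive.

Import Order.TTheory GRing.Theory Num.Theory numFieldNormedType.Exports.
Local Open Scope set_scope.
Local Open Scope ring_scope.

(** * Random subsets *)

(** The law of the random subset of [X] that contains each element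
    independently with probability [p]. *)
Definition subset_weight (R : pzRingType) (I : finType) (X : {set I}) (p : R)
    (G : {set I}) : R :=
  \prod_(e in X) (if e \in G then p else 1 - p).

Section RandomSubset.
Variables (R : realType) (I : finType) (X : {set I}).

(** Expansion of a product of sums, to which the sums below are reduced. *)
Lemma sum_powerset_prod (a b : I -> R) :
  \sum_(G in powerset X) \prod_(e in X) (if e \in G then a e else b e) =
  \prod_(e in X) (a e + b e).
Proof.
pose F e := if e \in X then a e else 0.
pose H e := if e \in X then b e else 1.
have -> : \prod_(e in X) (a e + b e) = \prod_e (F e + H e).
  rewrite [LHS]big_mkcond; apply: eq_bigr => e _.
  by rewrite /F /H; case: ifP => // _; rewrite add0r.
rewrite bigA_distr [LHS]big_mkcond; apply: eq_big => // G _.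
rewrite inE; case: ifP => [/fintype.subsetP GX | /negbT/fintype.subsetPn[e eG eX]].
  rewrite [LHS]big_mkcond; apply: eq_bigr => e _; rewrite /F /H.
  by case: ifP => eX; case: ifP => eG //; rewrite (GX e eG) in eX.
by rewrite (bigD1 e) //= eG /F (negbTE eX) mul0r.
Qed.

Variables (p : R) (p01 : 0 <= p <= 1).

Let p_ge0 : 0 <= p. Proof. by case/andP: p01. Qed.
Let q_ge0 : 0 <= 1 - p. Proof. by rewrite subr_ge0; case/andP: p01. Qed.

Lemma subset_weight_ge0 G : 0 <= subset_weight X p G.
Proof. by apply: prodr_ge0 => e _; case: ifP. Qed.

Lemma sum_subset_weight : \sum_(G in powerset X) subset_weight X p G = 1.
Proof.
rewrite (sum_powerset_prod (fun=> p) (fun=> 1 - p)).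
by apply: big1 => e _; rewrite addrC subrK.
Qed.

Lemma sum_subset_weight_exp (l : R) :
  \sum_(G in powerset X) subset_weight X p G * l ^+ #|G| =
  (1 + p * (l - 1)) ^+ #|X|.
Proof.
have -> : (1 + p * (l - 1)) ^+ #|X| = \prod_(e in X) (p * l + (1 - p)).
  by rewrite prodr_const; congr (_ ^+ _); ring.
rewrite -(sum_powerset_prod (fun=> p * l) (fun=> 1 - p)).
apply: eq_bigr => G; rewrite inE => GX.
have -> : l ^+ #|G| = \prod_(e in X) (if e \in G then l else 1).
  by rewrite -big_mkcondr -prodr_const; apply: eq_bigl => e;
     case: (boolP (e \in G)) => [/(fintype.subsetP GX)->|]; rewrite ?andbF.
rewrite -big_split /=; apply: eq_bigr => e _.
by case: ifP; rewrite ?mulr1.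
Qed.

Lemma sum_subset_weight_mem e : e \in X ->
  \sum_(G in powerset X | e \in G) subset_weight X p G = p.
Proof.
move=> eX.
rewrite [LHS]big_mkcondr.
transitivity (\sum_(G in powerset X) \prod_(f in X)
   (if f \in G then p else if f == e then 0 else 1 - p)).
  apply: eq_bigr => G _; case: ifP => eG.
    by apply: eq_bigr => f _; case: ifP => // fG; case: eqP fG => // ->; rewrite eG.
  by rewrite (bigD1 e) //= eG eqxx mul0r.
rewrite (sum_powerset_prod (fun=> p)) (bigD1 e) //= eqxx addr0.
rewrite big1 ?mulr1 // => f /andP[_ /negbTE->]; by rewrite addrC subrK.
Qed.

Lemma sum_subset_weight_card :
  \sum_(G in powerset X) subset_weight X p G * #|G|%:R = p * #|X|%:R.
Proof.
transitivity (\sum_(G in powerset X) \sum_(e in X | e \in G)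
    subset_weight X p G).
  apply: eq_bigr => G; rewrite inE => GX.
  rewrite mulr_natr -sumr_const; apply: eq_bigl => e.
  by case: (boolP (e \in G)) => [/(fintype.subsetP GX)->|]; rewrite ?andbF.
rewrite (exchange_big_dep (mem X)) /=; last by move=> G e _ /andP[].
under eq_bigr => e eX.
  under eq_bigl => G do rewrite eX /=.
  rewrite sum_subset_weight_mem //; over.
by rewrite sumr_const mulr_natr.
Qed.

(** The condition [S :\: D == G] prescribes [S] outside [D] and leaves it free
    inside, so the sum on the right is the weight of [G] without the factors
    [1 - p] contributed by the elements of [D]. *)
Lemma subset_weight_setD (G D : {set I}) :
  G \subset X -> D \subset X -> [disjoint D & G] ->
  subset_weight X p G <=
  (1 - p) ^+ #|D| * \sum_(S in powerset X | S :\: D == G) subset_weight X p S.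
Proof.
move=> GX DX DG.
pose a e := if e \in D then p else if e \in G then p else 0.
pose b e := if e \in D then 1 - p else if e \in G then 0 else 1 - p.
have -> : subset_weight X p G = (1 - p) ^+ #|D| * \prod_(e in X) (a e + b e).
  have -> : (1 - p) ^+ #|D| = \prod_(e in X) (if e \in D then 1 - p else 1).
    by rewrite -big_mkcondr -prodr_const; apply: eq_bigl => e;
       case: (boolP (e \in D)) => [/(fintype.subsetP DX)->|]; rewrite ?andbF.
  rewrite -big_split /=; apply: eq_bigr => e _; rewrite /a /b.
  case: (boolP (e \in D)) => eD.
    by rewrite (disjointFr DG eD) [p + _]addrC subrK mulr1.
  by case: ifP => _; rewrite mul1r ?addr0 ?add0r.
apply: ler_wpM2l; first exact: exprn_ge0.
rewrite -sum_powerset_prod big_mkcondr /=.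
apply: ler_sum => S SX; rewrite inE in SX; case: eqP => [SDG | /eqP SDG].
  apply: ler_prod => e _; rewrite /a /b -SDG !inE.
  by case: (e \in S); case: (e \in D); rewrite /= ?lexx ?p_ge0 ?q_ge0.
suff [e [eX eD eS]] : exists e, [/\ e \in X, e \notin D & (e \in S) != (e \in G)].
  rewrite (bigD1 e) //= /a /b (negbTE eD); move: eS.
  by case: (e \in S); case: (e \in G) => //= _; rewrite mul0r.
have [//|noe] := pselect (exists e, [/\ e \in X, e \notin D & (e \in S) != (e \in G)]).
case/negP: SDG; apply/eqP/setP => e; rewrite inE.
case: (boolP (e \in D)) => eD /=; first by rewrite (disjointFr DG eD).
apply/eqP; apply: contra_notT noe => eSG; exists e; split=> //.
have [/(fintype.subsetP SX) //|eS] := boolP (e \in S).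
by apply: (fintype.subsetP GX); move: eSG; rewrite (negbTE eS); case: (e \in G).
Qed.

(** A union bound that counts only the traces of the family on a random set. If
    [D] misses [G], then by [subset_weight_setD] the weight of [G] is spread,
    up to the factor [c], over the sets [S] with [S :\: D = G]. Conversely
    [S] receives weight from at most one [G] per trace, as
    [G = S :\: (D :&: S)]. *)
Lemma subset_weight_avoid (fam : {set I} -> Prop) (c : R) (tau : {set I} -> R) :
  0 <= c -> (forall D, fam D -> D \subset X /\ (1 - p) ^+ #|D| <= c) ->
  (forall S : {set I}, S \subset X ->
     #|[set H : {set I} |
         `[< exists2 D : {set I}, fam D & H = D :&: S >]]|%:R <= tau S) ->
  \sum_(G in powerset X | `[< exists2 D : {set I}, fam D & [disjoint D & G] >])
     subset_weight X p G <=
  c * \sum_(S in powerset X) subset_weight X p S * tau S.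
Proof.
move=> c_ge0 famP tauP.
have [wit witP] : {wit : {set I} -> {set I} & forall G : {set I},
    (exists2 D : {set I}, fam D & [disjoint D & G]) ->
    fam (wit G) /\ [disjoint (wit G) & G]}.
  apply: (@boolp.choice _ _ (fun G D : {set I} =>
    (exists2 D : {set I}, fam D & [disjoint D & G]) ->
    fam D /\ [disjoint D & G])) => G.
  have [[D fD DG]|no] := pselect (exists2 D : {set I}, fam D & [disjoint D & G]).
    by exists D.
  by exists G => /no.
pose bad (G : {set I}) := `[< exists2 D : {set I}, fam D & [disjoint D & G] >].
have step G : G \in powerset X -> bad G -> subset_weight X p G <=
    c * \sum_(S in powerset X | S :\: wit G == G) subset_weight X p S.
  rewrite inE => GX /asboolP/witP[fD DG]; have [DX Dc] := famP _ fD.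
  apply: le_trans (subset_weight_setD GX DX DG) _.
  by apply: ler_wpM2r => //; apply: sumr_ge0 => S _; apply: subset_weight_ge0.
have -> : \sum_(G in powerset X | bad G) subset_weight X p G =
   \sum_(G | (G \in powerset X) && bad G) subset_weight X p G by [].
apply: (@le_trans _ _ (\sum_(G | (G \in powerset X) && bad G)
   c * \sum_(S in powerset X | S :\: wit G == G) subset_weight X p S)).
  by apply: ler_sum => G /andP[]; apply: step.
rewrite -mulr_sumr; apply: ler_wpM2l => //.
rewrite (exchange_big_dep (mem (powerset X))) /=; last by move=> G S _ /andP[].
apply: ler_sum => S SX; rewrite sumr_const -mulr_natr.
apply: ler_wpM2l; first exact: subset_weight_ge0.
rewrite inE in SX; apply: le_trans (tauP S SX); rewrite ler_nat.
set Gs := (X in (#|X| <= _)%N).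
have SDK : {in Gs, forall G, S :\: (S :\: G) = G}.
  move=> G; rewrite /Gs inE => /andP[_ /andP[_ /eqP <-]].
  by apply/setP => e; rewrite !inE; case: (e \in S); rewrite ?andbF //= !andbT negbK.
rewrite -(card_in_imset (f := fun G => S :\: G) (D := Gs)); last first.
  by move=> G H GG HG /= e; rewrite -[LHS](SDK _ GG) e SDK.
apply/subset_leq_card/fintype.subsetP => _ /imsetP[G GGs ->].
have := GGs; rewrite /Gs inE => /andP[/andP[_ /asboolP/witP[fD _]] /andP[_ /eqP SG]].
rewrite inE; exists (wit G) => //.
by rewrite -{1}SG finset.setDDr finset.setDv finset.set0U finset.setIC.
Qed.

End RandomSubset.

(** * Zero patterns of polynomials *)
Section Box.
Variables (R : comNzRingType) (J : finType).
Implicit Types (b : J -> nat) (f g : (J -> R) -> R).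

Definition monom (m : J -> nat) (x : J -> R) : R := \prod_j x j ^+ m j.

(** Polynomial functions of degree at most [b j] in the variable [x j]. The
    terms form a list with possible repetitions, so that sums and products
    amount to concatenation and to pairing of lists. *)
Definition in_box b f : Prop :=
  exists2 s : seq (R * {ffun J -> nat}),
    forall t, t \in s -> forall j, (t.2 j <= b j)%N
    & forall x, f x = \sum_(t <- s) t.1 * monom t.2 x.

Lemma in_box_ext b f g : f =1 g -> in_box b f -> in_box b g.
Proof. by move=> fg [s sb sf]; exists s => // x; rewrite -fg. Qed.

Lemma in_box_le b b' f : (forall j, b j <= b' j)%N -> in_box b f -> in_box b' f.
Proof.
move=> bb' [s sb sf]; exists s => // t ts j.
exact: leq_trans (sb t ts j) (bb' j).
Qed.

Lemma in_box_const b c : in_box b (fun=> c).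
Proof.
exists [:: (c, [ffun=> 0%N])] => [t | x].
  by rewrite inE => /eqP-> j; rewrite ffunE.
by rewrite big_seq1 /monom big1 ?mulr1 // => j _; rewrite ffunE expr0.
Qed.

Lemma in_box_var i : in_box (fun j => (j == i) : nat) (fun x => x i).
Proof.
exists [:: (1, [ffun j => (j == i) : nat])] => [t | x].
  by rewrite inE => /eqP-> j; rewrite ffunE.
rewrite big_seq1 mul1r /monom (bigD1 i) //= ffunE eqxx expr1.
by rewrite big1 ?mulr1 // => j /negbTE ji; rewrite ffunE ji expr0.
Qed.

Lemma in_boxD b f g : in_box b f -> in_box b g -> in_box b (fun x => f x + g x).
Proof.
move=> [s sb sf] [t tb tg]; exists (s ++ t) => [r | x].
  by rewrite mem_cat => /orP[/sb | /tb].
by rewrite big_cat /= -sf -tg.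
Qed.

Lemma in_boxM b b' f g : in_box b f -> in_box b' g ->
  in_box (fun j => b j + b' j)%N (fun x => f x * g x).
Proof.
move=> [s sb sf] [t tb tg].
pose h (r r' : R * {ffun J -> nat}) : R * {ffun J -> nat} :=
  (r.1 * r'.1, [ffun j => (r.2 j + r'.2 j)%N]).
exists [seq h r r' | r <- s, r' <- t].
  move=> _ /allpairsP[[r r'] /= [rs r't ->]] j /=; rewrite ffunE.
  by apply: leq_add; [apply: sb | apply: tb].
move=> x; rewrite big_allpairs_dep sf tg big_distrlr /=.
apply: eq_bigr => r _; apply: eq_bigr => r' _.
rewrite mulrACA; congr (_ * _); rewrite /monom -big_split /=.
by apply: eq_bigr => j _; rewrite ffunE exprD.
Qed.

Lemma in_boxN b f : in_box b f -> in_box b (fun x => - f x).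
Proof.
move=> bf; apply: (in_box_ext (f := fun x => -1 * f x)) => [x|].
  by rewrite mulN1r.
by apply: in_box_le (in_boxM (in_box_const (fun=> 0%N) _) bf).
Qed.

Lemma in_box_sum b (K : finType) (P : pred K) (F : K -> (J -> R) -> R) :
  (forall k, P k -> in_box b (F k)) -> in_box b (fun x => \sum_(k | P k) F k x).
Proof.
move=> bF.
suff box_seq (s : seq K) : in_box b (fun x => \sum_(k <- s | P k) F k x).
  exact: box_seq.
elim: s => [|k s IHs].
  by apply: in_box_ext (in_box_const b 0) => x; rewrite big_nil.
case: (boolP (P k)) => Pk.
  by apply: in_box_ext (in_boxD (bF _ Pk) IHs) => x; rewrite big_cons Pk.
by apply: in_box_ext IHs => x; rewrite big_cons (negbTE Pk).
Qed.

Lemma in_box_prod (K : finType) (A : {set K}) (b : K -> J -> nat)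
    (F : K -> (J -> R) -> R) :
  (forall k, k \in A -> in_box (b k) (F k)) ->
  in_box (fun j => \sum_(k in A) b k j)%N (fun x => \prod_(k in A) F k x).
Proof.
move=> bF.
suff box_seq (s : seq K) : in_box (fun j => \sum_(k <- s | k \in A) b k j)%N
    (fun x => \prod_(k <- s | k \in A) F k x) by exact: box_seq.
elim: s => [|k s IHs].
  apply: in_box_le (in_box_ext _ (in_box_const (fun=> 0%N) 1)) => [//|x].
  by rewrite big_nil.
case: (boolP (k \in A)) => kA.
  apply: in_box_le (in_box_ext _ (in_boxM (bF _ kA) IHs)) => [j|x];
  by rewrite big_cons kA.
apply: in_box_le (in_box_ext _ IHs) => [j|x];
by rewrite big_cons (negbTE kA).
Qed.

(** Collecting like terms shows that the functions of a box lie in the span of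
    [\prod_j (b j).+1] fixed monomials. *)
Lemma in_box_coef b f : in_box b f ->
  exists c : {dffun forall j, 'I_(b j).+1} -> R,
    forall x, f x = \sum_m c m * monom (fun j => m j) x.
Proof.
move=> [s sb sf].
exists (fun m : {dffun forall j, 'I_(b j).+1} =>
  \sum_(t <- s | [forall j, t.2 j == m j]) t.1) => x.
under eq_bigr => m _ do rewrite mulr_suml.
rewrite (exchange_big_dep xpredT) //= sf big_seq_cond [RHS]big_seq_cond.
apply: eq_bigr => t; rewrite andbT => ts.
pose m : {dffun forall j, 'I_(b j).+1} := [ffun j => inord (t.2 j)].
have tm j : t.2 j = m j by rewrite ffunE inordK ?ltnS ?sb.
rewrite (big_pred1 m) => [|m'].
  by congr (_ * _); apply: eq_bigr => j _; rewrite tm.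
apply/forallP/eqP => [tm' | -> j]; last by rewrite tm.
by apply/ffunP => j; apply/val_inj; rewrite /= -tm; apply/esym/eqP.
Qed.

End Box.

(** The witness of [H] is a point where the product indexed by [H'] is nonzero
    exactly when [H'] is contained in [H]. The matrix of these values is thus
    triangular for inclusion with a nonzero diagonal, so the products are
    linearly independent in a space spanned by [\prod_j (b j).+1] monomials. *)
Lemma card_patterns_le (F : fieldType) (J K : finType) (b : J -> nat)
    (f : K -> (J -> F) -> F) (T : {set {set K}}) :
  (forall H, H \in T -> in_box b (fun x => \prod_(k in H) f k x)) ->
  (forall H, H \in T ->
     exists x, forall H', H' \in T ->
       (\prod_(k in H') f k x != 0) = (H' \subset H)) ->
  (#|T| <= \prod_j (b j).+1)%N.
Proof.
move=> boxT wit.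
have witE (i : 'I_#|T|) := wit _ (enum_valP i).
have [pt ptP] := boolp.choice witE.
have [c cP] := boolp.choice (fun i : 'I_#|T| => in_box_coef (boxT _ (enum_valP i))).
pose M := {dffun forall j, 'I_(b j).+1} : finType.
(* [C *m E] holds the values of the products at the witnesses, factored
   through the monomials. *)
pose C := \matrix_(i < #|T|, m < #|M|) c i (enum_val m).
pose E := \matrix_(m < #|M|, i < #|T|) monom (fun j => (enum_val m : M) j) (pt i).
have CE i i' : (C *m E) i i' = \prod_(k in enum_val i) f k (pt i').
  rewrite mxE cP (reindex_onto (enum_val : 'I_#|M| -> M) enum_rank) /=; last first.
    by move=> m _; rewrite enum_rankK.
  by apply: eq_big => [m|m _]; rewrite ?enum_valK ?eqxx // !mxE.
suff /eqP rkCE : row_free (C *m E).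
  rewrite -rkCE; apply: leq_trans (mulmx_max_rank _ _) _.
  rewrite card_dep_ffun foldrE big_map big_enum.
  by apply/eq_leq/eq_bigr => j _; rewrite card_ord.
apply: inj_row_free => a aCE0; apply/eqP/negPn/negP => a_neq0.
have /rV0Pn[i0 ai0] := a_neq0.
(* In a linear relation, take a smallest pattern with nonzero coefficient: all
   other terms vanish at its witness. *)
case: (@arg_minnP _ i0 (fun i => a 0 i != 0)
  (fun i : 'I_#|T| => #|(enum_val i : {set K})|) ai0) => i ai imin.
have /matrixP/(_ 0 i) := aCE0; rewrite !mxE (bigD1 i) //= big1 => [|i' i'i].
  rewrite addr0 CE => /eqP; rewrite mulf_eq0 (negbTE ai) /=; apply/negP.
  by rewrite ptP ?enum_valP.
apply/eqP; rewrite mulf_eq0; apply/orP.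
have [|ai'] := eqVneq (a 0 i') 0; [by left | right].
rewrite CE; apply/negPn; rewrite ptP ?enum_valP //.
apply: contra i'i => sub; apply/eqP/enum_val_inj/eqP.
by rewrite eqEcard sub imin.
Qed.

(** * Patterns of discord *)
Section Patterns.
Variables (R : realType) (d n : nat) (v : 'I_n -> 'rV[R]_d).
Implicit Types (u : 'I_n -> 'rV[R]_d) (S e : {set 'I_n}).

Definition sqdist (x y : 'rV[R]_d) : R := \sum_(k < d) (x 0 k - y 0 k) ^+ 2.

Lemma sqdist_ge0 x y : 0 <= sqdist x y.
Proof. by apply: sumr_ge0 => k _; apply: sqr_ge0. Qed.

Lemma sqdistC x y : sqdist x y = sqdist y x.
Proof. by apply: eq_bigr => k _; rewrite -sqrrN opprB. Qed.

Lemma sqdistxx x : sqdist x x = 0.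
Proof. by apply: big1 => k _; rewrite subrr expr0n. Qed.

Lemma sqdist_eq0 x y : (sqdist x y == 0) = (x == y).
Proof.
apply/idP/eqP => [|->]; last by rewrite sqdistxx.
rewrite psumr_eq0 => [/allP xy|k _]; last exact: sqr_ge0.
apply/rowP => k; apply/eqP; rewrite -subr_eq0 -sqrf_eq0.
by apply: xy; rewrite mem_index_enum.
Qed.

Lemma eucl_dist_eq (x y z t : 'rV[R]_d) :
  eucl_dist x y = eucl_dist z t <-> sqdist x y = sqdist z t.
Proof.
split => [/eqP|e]; last by congr Num.sqrt.
by rewrite eqr_sqrt ?sqdist_ge0 // => /eqP.
Qed.

(** The sum over all ordered pairs avoids a choice of the first vertex of [e].
    For a pair of distinct vertices it is twice the difference of the squared
    distances, a polynomial in the coordinates of [u]. *)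
Definition defect u e : R :=
  \sum_(i in e) \sum_(j in e) (sqdist (u i) (u j) - sqdist (v i) (v j)).

Lemma defect_pair u i j : i != j ->
  (defect u [set i; j] == 0) = (sqdist (u i) (u j) == sqdist (v i) (v j)).
Proof.
have set2_sum (F : 'I_n -> R) : i != j -> \sum_(l in [set i; j]) F l = F i + F j.
  by move=> ij; rewrite big_setU1 ?inE // big_set1.
move=> ij; rewrite /defect !set2_sum // !sqdistxx subrr add0r addr0.
rewrite [sqdist (u j) _]sqdistC [sqdist (v j) _]sqdistC -mulr2n.
by rewrite mulrn_eq0 /= subr_eq0.
Qed.

Lemma in_box_defect e :
  in_box (fun t : 'I_n * 'I_d => (t.1 \in e).*2)
    (fun x => defect (fun i => \row_k x (i, k)) e).
Proof.
apply: in_box_sum => i ie; apply: in_box_sum => j je.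
apply: in_boxD; last exact: in_box_const.
apply: in_box_sum => k _.
have box_coord l : l \in e -> in_box (fun t : 'I_n * 'I_d => (t.1 \in e) : nat)
    (fun x => (\row_k' x (l, k') : 'rV[R]_d) 0 k).
  move=> le; apply: in_box_ext (in_box_le _ (in_box_var R (l, k))) => [x|t].
    by rewrite mxE.
  by case: eqP => // ->; rewrite le.
have box_diff := in_boxD (box_coord i ie) (in_boxN (box_coord j je)).
apply: in_box_ext (in_box_le _ (in_boxM box_diff box_diff)) => [x|t].
  by rewrite expr2.
by rewrite addnn.
Qed.

Definition degree (S : {set {set 'I_n}}) (i : 'I_n) : nat :=
  #|[set e in S | i \in e]|.

Lemma sum_degree (S : {set {set 'I_n}}) : S \subset vpairs n ->
  (\sum_i degree S i = #|S|.*2)%N.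
Proof.
move=> Spairs.
transitivity (\sum_i \sum_(e in S | i \in e) 1)%N.
  by apply: eq_bigr => i _; rewrite sum1dep_card.
rewrite (exchange_big_dep (mem S)) /=; last by move=> i e _ /andP[].
transitivity (\sum_(e in S) 2)%N; last by rewrite sum_nat_const muln2.
apply: eq_bigr => e eS; have := fintype.subsetP Spairs e eS.
by rewrite inE eS /= => /eqP <-; rewrite sum1_card.
Qed.

Lemma card_defect_patterns (S : {set {set 'I_n}}) :
  (#|[set H : {set {set 'I_n}} |
       `[< exists u, H = [set e in S | defect u e != 0%R] >]]|
   <= \prod_(t : 'I_n * 'I_d) ((degree S t.1).*2).+1)%N.
Proof.
pose f e (x : 'I_n * 'I_d -> R) := defect (fun i => \row_k x (i, k)) e.
apply: (card_patterns_le (f := f)) => [H | H].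
  rewrite inE => /asboolP[u HE].
  apply: in_box_le (in_box_prod (fun e _ => in_box_defect e)) => t.
  rewrite /degree -sum1dep_card big_mkcondr /= -muln2 big_distrl /=.
  rewrite [leqRHS](big_setID H) /=.
  apply: leq_trans (leq_addr _ _).
  have -> : S :&: H = H by rewrite HE; apply/setP => e; rewrite !inE; case: (e \in S).
  by apply: eq_leq; apply: eq_bigr => e _; rewrite muln2; case: ifP.
rewrite inE => /asboolP[u HE]; exists (fun t => u t.1 0 t.2) => H'.
rewrite inE => /asboolP[u' HE'].
have fE e : f e (fun t => u t.1 0 t.2) = defect u e.
  by apply: eq_bigr => i _; apply: eq_bigr => j _;
     congr (sqdist _ _ - _); apply/rowP => k; rewrite mxE.
apply/idP/fintype.subsetP => [/prodf_neq0 nz e eH'|sub].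
  rewrite HE inE -fE nz // andbT.
  by move: eH'; rewrite HE' inE => /andP[].
apply/prodf_neq0 => e /sub; rewrite HE inE fE => /andP[] //.
Qed.

(** The dimension of the box of [card_defect_patterns] is at most exponential
    in [n + #|S|], with a base for [#|S|] as close to 1 as desired: by
    Bernoulli's inequality [2 * k + 1 <= (1 + 2 / h) * (1 + h) ^ k], and the
    degrees sum to [2 * #|S|]. *)
Lemma degree_weight_le (h : R) (S : {set {set 'I_n}}) : 0 < h -> S \subset vpairs n ->
  (\prod_(t : 'I_n * 'I_d) ((degree S t.1).*2).+1)%:R <=
  (1 + 2 / h) ^+ (n * d) * (1 + h) ^+ (d.*2 * #|S|) :> R.
Proof.
move=> h0 Spairs; rewrite natr_prod.
have bern m : 1 + m%:R * h <= (1 + h) ^+ m.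
  elim: m => [|m IHm]; first by rewrite mul0r addr0.
  rewrite exprS; apply: (@le_trans _ _ ((1 + h) * (1 + m%:R * h))).
    have : 0 <= m%:R * h * h by rewrite !mulr_ge0 // ltW.
    rewrite -natr1; lra.
  by rewrite ler_pM2l // ltr_wpDl.
apply: (@le_trans _ _ (\prod_(t : 'I_n * 'I_d)
   ((1 + 2 / h) * (1 + h) ^+ degree S t.1))).
  apply: ler_prod => t _; rewrite ler0n /=.
  set m := degree S t.1.
  apply: (@le_trans _ _ ((1 + 2 / h) * (1 + m%:R * h))).
    rewrite -addn1 -muln2 natrD natrM.
    have -> : (1 + 2 / h) * (1 + m%:R * h) = 1 + m%:R * h + 2 / h + m%:R * 2.
      by field; rewrite gt_eqF.
    have : 0 <= 2 / h by rewrite divr_ge0 // ltW.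
    have : 0 <= m%:R * h by rewrite mulr_ge0 // ltW.
    lra.
  by rewrite ler_wpM2l // addr_ge0 // divr_ge0 // ltW.
rewrite big_split /= prodr_const card_prod !card_ord.
rewrite ler_wpM2l ?exprn_ge0 ?addr_ge0 ?divr_ge0 ?(ltW h0) //.
rewrite prodrXr; have -> // : (\sum_(t : 'I_n * 'I_d) degree S t.1 = d.*2 * #|S|)%N.
rewrite -(pair_bigA _ (fun i _ => degree S i)) /=.
under eq_bigr do rewrite sum_nat_const card_ord.
by rewrite -big_distrr /= sum_degree // -mul2n -mul2n mulnCA mulnA.
Qed.

(** Pairs inside [B] are ignored because a configuration obtained by gluing
    two others is not controlled inside the set where both differ from [v]. *)
Definition discord (N : {set 'I_n}) u (B : {set 'I_n}) : {set {set 'I_n}} :=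
  [set e in vpairs n | [&& e \subset N, ~~ (e \subset B) & defect u e != 0]].

(** A trace is a pattern of nonzero defects restricted to the pairs inside [N]
    and not inside [B]; the factor [2 ^ n] accounts for the choice of [B]. *)
Lemma card_discord_traces (h : R) (N : {set 'I_n}) (S : {set {set 'I_n}})
    (fam : {set {set 'I_n}} -> Prop) :
  (forall D : {set {set 'I_n}}, fam D -> exists u B, D = discord N u B) ->
  0 < h -> S \subset vpairs n ->
  #|[set H : {set {set 'I_n}} | `[< exists2 D, fam D & H = D :&: S >]]|%:R <=
  (2 * (1 + 2 / h) ^+ d) ^+ n * ((1 + h) ^+ d.*2) ^+ #|S| :> R.
Proof.
move=> famP h0 Spairs; rewrite exprMn -!exprM [(d * n)%N]mulnC -mulrA.
apply: le_trans (ler_wpM2l (exprn_ge0 n _) (degree_weight_le h0 Spairs)) => //.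
have -> : 2 ^+ n = #|powerset [set: 'I_n]|%:R :> R.
  by rewrite card_powerset cardsT card_ord natrX.
set T := [set H : {set {set 'I_n}} |
       `[< exists u, H = [set e in S | defect u e != 0] >]].
rewrite mulrC; apply: (@le_trans _ _ (#|T|%:R * #|powerset [set: 'I_n]|%:R)); last first.
  by apply: ler_wpM2r => //; rewrite ler_nat card_defect_patterns.
rewrite -natrM ler_nat -cardsX.
pose cut (t : {set {set 'I_n}} * {set 'I_n}) : {set {set 'I_n}} :=
  [set e in t.1 | (e \subset N) && ~~ (e \subset t.2)].
apply: leq_trans (leq_imset_card cut _).
apply/subset_leq_card/fintype.subsetP => H; rewrite inE => /asboolP[D /famP[u [B ->]] ->].
apply/imsetP; exists ([set e in S | defect u e != 0], B).
  by rewrite !inE /= finset.subsetT andbT; apply/asboolP; exists u.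
apply/setP => e; rewrite !inE /=.
case: (boolP (e \in S)) => [/(fintype.subsetP Spairs)|]; last by rewrite andbF.
by rewrite inE => ->; rewrite andbT /= andbA andbC.
Qed.

End Patterns.

(** * Isometries and bisectors *)
Section Isometries.
Variables (R : realType) (d : nat).
Implicit Types x y z a b : 'rV[R]_d.

Definition dot x y : R := \sum_k x 0 k * y 0 k.

Lemma dotC x y : dot x y = dot y x.
Proof. by apply: eq_bigr => k _; rewrite mulrC. Qed.

Lemma dotDl x y z : dot (x + y) z = dot x z + dot y z.
Proof. by rewrite -big_split /=; apply: eq_bigr => k _; rewrite mxE mulrDl. Qed.

Lemma dotZl c x y : dot (c *: x) y = c * dot x y.
Proof. by rewrite /dot mulr_sumr; apply: eq_bigr => k _; rewrite mxE mulrA. Qed.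

Lemma dotBl x y z : dot (x - y) z = dot x z - dot y z.
Proof. by rewrite dotDl -scaleN1r dotZl mulN1r. Qed.

Lemma dotBr x y z : dot z (x - y) = dot z x - dot z y.
Proof. by rewrite dotC dotBl !(dotC z). Qed.

Lemma sqdistE x y : sqdist x y = dot (x - y) (x - y).
Proof. by apply: eq_bigr => k _; rewrite !mxE expr2. Qed.

Definition isometry (phi : 'rV[R]_d -> 'rV[R]_d) : Prop :=
  forall x y, sqdist (phi x) (phi y) = sqdist x y.

Lemma exists_reflection a b : exists2 phi, isometry phi &
  phi a = b /\ forall x, sqdist x a = sqdist x b -> phi x = x.
Proof.
have [<-|ab] := eqVneq a b; first by exists id.
pose m := a - b.
have m_neq0 : dot m m != 0 by rewrite -sqdistE sqdist_eq0.
pose coef x := (2 * dot x m - dot (a + b) m) / dot m m.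
exists (fun x => x - coef x *: m) => [x y|]; last split.
- have -> : coef x = coef y + 2 * dot (x - y) m / dot m m.
    by rewrite /coef dotBl; field.
  rewrite !sqdistE; set t := 2 * _ / _.
  have -> : x - (coef y + t) *: m - (y - coef y *: m) = (x - y) - t *: m.
    by apply/rowP => k; rewrite !mxE; ring.
  move: (x - y) @t => z t.
  rewrite dotBl !dotBr dotZl dotZl [dot z (t *: m)]dotC dotZl.
  rewrite [dot m (t *: m)]dotC dotZl [dot m z]dotC /t.
  by field.
- rewrite /coef dotDl.
  have -> : 2 * dot a m - (dot a m + dot b m) = dot m m by rewrite {4}/m dotBl; ring.
  by rewrite divff // scale1r /m opprB addrC subrK.
move=> x xab; suff -> : coef x = 0 by rewrite scale0r subr0.
apply/eqP; rewrite mulf_eq0; apply/orP; left; apply/eqP.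
move: xab; rewrite !sqdistE /m !dotBl !dotBr !dotDl.
rewrite (dotC a x) (dotC b x) (dotC b a); lra.
Qed.

(** One reflection per point: the bisector of the current image of [u i] and
    of its target contains the targets already attained, since these are at
    the same distance from both. *)
Lemma exists_isometry (I : eqType) (u v : I -> 'rV[R]_d) (s : seq I) :
  {in s &, forall i j, sqdist (u i) (u j) = sqdist (v i) (v j)} ->
  exists2 phi, isometry phi & {in s, forall i, phi (u i) = v i}.
Proof.
elim: s => [|i s IHs] uv; first by exists id.
have [j k js ks|phi phi_iso phi_s] := IHs.
  by apply: uv; rewrite inE ?js ?ks orbT.
have [psi psi_iso [psi_i psi_fix]] := exists_reflection (phi (u i)) (v i).
exists (psi \o phi) => [x y|j]; first by rewrite /= psi_iso phi_iso.
rewrite inE => /orP[/eqP-> //|js] /=.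
rewrite phi_s // psi_fix // -{1}(phi_s j js) phi_iso.
by apply: uv; rewrite inE ?js ?eqxx ?orbT.
Qed.

(** Homogeneous coordinates: affine functions of [x] are linear functions of
    [homog x]. *)
Definition homog x : 'rV[R]_(1 + d) := row_mx 1%:M x.

Lemma exists_bisector a b : exists c : 'cV[R]_(1 + d),
  forall x, (homog x *m c == 0) = (sqdist a x == sqdist b x).
Proof.
exists (col_mx (dot a a - dot b b)%:M ((-2) *: (a - b)^T)) => x.
have -> : homog x *m col_mx (dot a a - dot b b)%:M ((-2) *: (a - b)^T) =
    (sqdist a x - sqdist b x)%:M.
  rewrite mul_row_col mul1mx -scalemxAr; apply/matrixP => i j.
  rewrite !ord1 !mxE /= !mulr1n.
  have -> : \sum_k x 0 k * (a - b)^T k 0 = dot x (a - b).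
    by apply: eq_bigr => k _; rewrite !mxE.
  by rewrite !sqdistE !dotBr !dotBl (dotC x a) (dotC x b); ring.
rewrite -[RHS]subr_eq0; apply/eqP/eqP => [/matrixP/(_ 0 0)|->].
  by rewrite !mxE mulr1n.
by apply/matrixP => i j; rewrite !mxE mul0rn.
Qed.

End Isometries.

(** * Points in robust position *)
Lemma card_bigcup_le (R : numDomainType) (I J : finType) (A : {set I})
    (F : I -> {set J}) (k : nat) (s : R) :
  0 <= s -> (#|A| <= k)%N -> (forall i, i \in A -> #|F i|%:R <= s) ->
  #|\bigcup_(i in A) F i|%:R <= k%:R * s.
Proof.
move=> s0 Ak Fs.
apply: (@le_trans _ _ (\sum_(i in A) #|F i|%:R)).
  rewrite -natr_sum ler_nat.
  apply: (big_ind2 (fun (B : {set J}) l => #|B| <= l)%N) => [|B l C l' Bl Cl'|//].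
    by rewrite cards0.
  by apply: leq_trans (leq_add Bl Cl'); rewrite cardsU leq_subr.
apply: (@le_trans _ _ (\sum_(i in A) s)); first exact: ler_sum.
by rewrite sumr_const -[leLHS]mulr_natl ler_wpM2r // ler_nat.
Qed.

Section RobustSubset.
Variables (R : realType) (n m : nat) (w : 'I_n -> 'rV[R]_m) (g : R).
Implicit Types (N I : {set 'I_n}) (c : 'cV[R]_m).

(** Its row space is the span of the vectors indexed by [N]. *)
Definition rows_of N : 'M[R]_(n, m) := \matrix_i (if i \in N then w i else 0).

Lemma rows_of_sub i N : i \in N -> (w i <= rows_of N)%MS.
Proof. by move=> iN; have := row_sub i (rows_of N); rewrite rowK iN. Qed.

Lemma rows_ofS N N' : N \subset N' -> (rows_of N <= rows_of N')%MS.
Proof.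
move=> /fintype.subsetP NN'; apply/row_subP => i; rewrite rowK.
by case: ifP => [/NN'/rows_of_sub|_] //; apply: sub0mx.
Qed.

Lemma rows_of_mul0 N c :
  (forall i, i \in N -> w i *m c = 0) -> rows_of N *m c = 0.
Proof.
move=> Nc; apply/row_matrixP => i; rewrite row_mul rowK row0.
by case: ifP => [/Nc|_] //; rewrite mul0mx.
Qed.

Lemma rows_of_lt N N' c i : N \subset N' -> (forall j, j \in N -> w j *m c = 0) ->
  i \in N' -> w i *m c != 0 -> (\rank (rows_of N) < \rank (rows_of N'))%N.
Proof.
move=> NN' Nc iN' wic; apply: rank_ltmx.
rewrite ltmxE rows_ofS //=; apply: contra wic => N'N.
have /submxP[a ->] := submx_trans (rows_of_sub iN') N'N.
by rewrite -mulmxA rows_of_mul0 // mulmx0.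
Qed.

Definition robust N : Prop := forall c,
  (forall i, i \in N -> w i *m c = 0) \/
  g <= #|[set i in N | w i *m c != 0]|%:R.

(** Take [N] maximising [#|N| - g * rank]. If a hyperplane does not contain [N]
    but misses fewer than [g] of its vectors, then removing the vectors that it
    misses lowers the rank and increases this quantity. *)
Lemma exists_robust : 0 <= g ->
  exists2 N : {set 'I_n}, n%:R - g * m%:R <= #|N|%:R & robust N.
Proof.
move=> g0; pose F (N : {set 'I_n}) : R := #|N|%:R - g * (\rank (rows_of N))%:R.
case: (@arg_maxP _ _ _ [set: 'I_n] xpredT F isT) => N _ Nmax.
exists N.
  have := Nmax [set: 'I_n] isT; rewrite /F cardsT card_ord /Order.ge /=.
  have : g * (\rank (rows_of [set: 'I_n]))%:R <= g * m%:R.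
    by rewrite ler_wpM2l // ler_nat rank_leq_col.
  have : 0 <= g * (\rank (rows_of N))%:R by rewrite mulr_ge0.
  lra.
move=> c; set H := [set i in N | w i *m c != 0].
have [/set0Pn[i]|/negPn/eqP H0] := boolP (H != finset.set0).
  rewrite inE => /andP[iN wic]; right.
  have rk : (\rank (rows_of (N :\: H)) < \rank (rows_of N))%N.
    apply: (@rows_of_lt _ _ c i) => //; first exact: finset.subsetDl.
    by move=> j; rewrite !inE => /andP[/nandP[/negPf->//|/negPn/eqP]].
  have HN : H \subset N by apply/fintype.subsetP => j; rewrite inE => /andP[].
  have cardE : #|N|%:R = #|H|%:R + #|N :\: H|%:R :> R.
    by rewrite -natrD cardsDS // subnKC // subset_leq_card.
  have := Nmax (N :\: H) isT; rewrite /F /Order.ge /= cardE.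
  have : g * (\rank (rows_of (N :\: H))).+1%:R <= g * (\rank (rows_of N))%:R.
    by rewrite ler_wpM2l // ler_nat.
  rewrite -natr1 mulrDr mulr1; lra.
left=> i iN; apply/eqP/negPn/negP => wic.
by have : i \in H; [rewrite inE iN | rewrite H0 inE].
Qed.

(** A largest set of good, pairwise compatible, linearly independent vectors
    spans. Otherwise a hyperplane contains it but not all of [N], hence misses
    at least [g] vectors of [N]: more than those that are bad or incompatible
    with a chosen one. *)
Lemma exists_spanning_clique N (bad : {set 'I_n}) (dis : rel 'I_n) (s : R) :
  0 <= s -> robust N -> symmetric dis -> irreflexive dis ->
  (forall i, i \in N :\: bad -> #|[set j in N | dis i j]|%:R <= s) ->
  #|bad|%:R + m%:R * s < g ->
  exists I, [/\ I \subset N, (#|I| <= m)%N, {in I &, forall i j, ~~ dis i j},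
    (forall i, i \in I -> #|[set j in N | dis i j]|%:R <= s)
    & forall c, (forall i, i \in I -> w i *m c = 0) ->
        forall i, i \in N -> w i *m c = 0].
Proof.
move=> s0 Nrob dis_sym dis_irr dis_le few.
pose P (I : {set 'I_n}) := [&& I \subset N :\: bad, (#|I| <= \rank (rows_of I))%N
  & [forall i in I, forall j in I, ~~ dis i j]].
have P0 : P finset.set0.
  by rewrite /P finset.sub0set cards0 /=; apply/forall_inP => i; rewrite inE.
case: (@arg_maxnP _ finset.set0 P (fun I => #|I|) P0) => I /and3P[INb Irk Idis] Imax.
have Idis' : {in I &, forall i j, ~~ dis i j}.
  by move=> i j iI jI; apply: (forall_inP (forall_inP Idis i iI)).
have Im : (#|I| <= m)%N by apply: leq_trans Irk (rank_leq_col _).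
exists I; split=> //.
- by apply: fintype.subset_trans INb (finset.subsetDl _ _).
- by move=> i iI; apply: dis_le; apply: (fintype.subsetP INb).
move=> c Ic; have [//|Nc] := Nrob c.
exfalso.
pose near := \bigcup_(i in I) [set j in N | dis i j].
have near_le : #|near|%:R <= m%:R * s.
  by apply: card_bigcup_le => // i /(fintype.subsetP INb); apply: dis_le.
have [j jN [jb jnear jc]] :
    exists2 j, j \in N & [/\ j \notin bad, j \notin near & w j *m c != 0].
  have [//|none] := pselect (exists2 j, j \in N &
    [/\ j \notin bad, j \notin near & w j *m c != 0]).
  have sub : [set i in N | w i *m c != 0] \subset bad :|: near.
    apply/fintype.subsetP => i; rewrite !inE => /andP[iN ic].
    have [//|ib] := boolP (i \in bad); have [//|ine] := boolP (i \in near).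
    by case: none; exists i.
  have : (#|[set i in N | w i *m c != 0%R]| <= #|bad| + #|near|)%N.
    by apply: leq_trans (subset_leq_card sub) _; rewrite cardsU leq_subr.
  rewrite -(ler_nat R) natrD => h; exfalso; lra.
have jI : j \notin I.
  by apply: contra jc => /Ic ->.
have dis_j i : i \in I -> ~~ dis i j.
  move=> iI; apply: contra jnear => dij; apply/finset.bigcupP; exists i => //.
  by rewrite inE jN.
have : P (j |: I).
  apply/and3P; split.
  - by rewrite finset.subUset INb finset.sub1set inE jb jN.
  - rewrite cardsU1 jI add1n; apply: leq_ltn_trans Irk _.
    by apply: (@rows_of_lt _ _ c j); rewrite ?finset.setU11 // finset.subsetUr.
  apply/forall_inP => i; rewrite !inE => /predU1P[->|iI];
  apply/forall_inP => k; rewrite !inE => /predU1P[->|kI].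
  - by rewrite dis_irr.
  - by rewrite dis_sym dis_j.
  - exact: dis_j.
  - exact: Idis'.
by move=> /Imax; rewrite /= cardsU1 jI add1n ltnn.
Qed.

End RobustSubset.

(** * Displacements and gluing *)
Section Combination.
Variables (R : realType) (d n : nat) (v : 'I_n -> 'rV[R]_d).
Variables (N : {set 'I_n}) (g : R).
Hypotheses (g_gt0 : 0 < g) (Nrob : robust (fun i => homog (v i)) g N).
Implicit Types (u w : 'I_n -> 'rV[R]_d) (B : {set 'I_n}) (D G : {set {set 'I_n}}).

(** At most the number of discords that a displacement of moderate size
    forces, and small enough for fewer discords to leave a spanning set of
    vertices in general agreement. *)
Definition threshold : R := g ^+ 2 / (16 * (1 + d)%:R).

(** The handshake inequality, for pairs given by their two vertices. *)
Lemma sum_neighbours (D : {set {set 'I_n}}) : D \subset vpairs n ->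
  (\sum_i #|[set j | [set i; j] \in D]| <= #|D|.*2)%N.
Proof.
move=> Dpairs; rewrite -sum_degree //; apply: leq_sum => i _.
have pair_neq j : [set i; j] \in D -> i != j.
  by move/(fintype.subsetP Dpairs); rewrite inE cards2; case: (i != j).
rewrite -(card_in_imset (f := fun j => [set i; j])).
  apply/subset_leq_card/fintype.subsetP => e /imsetP[j]; rewrite inE => ijD ->.
  by rewrite !inE ijD eqxx.
move=> j k; rewrite !inE => ijD ikD /setP/(_ j); rewrite !inE eqxx orbT => /esym.
by rewrite eq_sym (negbTE (pair_neq _ ijD)) => /eqP.
Qed.

Lemma discord_pair u B i j :
  ([set i; j] \in discord v N u B) =
  [&& i \in N, j \in N, ~~ ((i \in B) && (j \in B))
    & sqdist (u i) (u j) != sqdist (v i) (v j)].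
Proof.
rewrite !inE cards2 !finset.subUset !finset.sub1set.
have [->|ij] := eqVneq i j; first by rewrite !sqdistxx eqxx !andbF.
by rewrite defect_pair // -andbA.
Qed.

Lemma discord_sub_pairs u B : discord v N u B \subset vpairs n.
Proof. by apply/fintype.subsetP => e; rewrite inE => /andP[]. Qed.

Lemma discord_pairP u B e : e \in discord v N u B -> exists i j, e = [set i; j].
Proof.
rewrite inE => /andP[]; rewrite inE => /cards2P[i [j [_ ->]]] _.
by exists i, j.
Qed.

(** By double counting, fewer than [g / 2] vertices are in discord with more than
    [s] others. Among the rest there are [1 + d] or fewer vertices of [N],
    pairwise not in discord, that span [N]; an isometry puts them at their places
    in [v]. A vertex of [N] in discord with none of them is then at its place
    too, because the bisector of its two positions contains the spanning
    vertices, hence its position in [v]. At most [(1 + d) * s = g / 4] vertices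
    remain. *)
Lemma small_displacement u :
  #|discord v N u finset.set0|%:R < threshold ->
  exists2 phi, isometry phi & #|[set i in N | phi (u i) != v i]|%:R <= g / 4.
Proof.
set D := discord _ _ _ _ => Dsmall.
pose dis : rel 'I_n := [rel i j | sqdist (u i) (u j) != sqdist (v i) (v j)].
pose s := g / (4 * (1 + d)%:R).
have m_gt0 : 0 < (1 + d)%:R :> R by rewrite ltr0n.
have s_gt0 : 0 < s by rewrite divr_gt0 // mulr_gt0.
pose nb i := #|[set j | [set i; j] \in D]|.
have dis_nb i : i \in N -> [set j in N | dis i j] = [set j | [set i; j] \in D].
  by move=> iN; apply/setP => j; rewrite [LHS]inE [RHS]inE /D discord_pair iN !inE.
pose bad := [set i | s < (nb i)%:R].
have bad_small : #|bad|%:R < g / 2.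
  rewrite -(ltr_pM2r s_gt0); apply: (@le_lt_trans _ _ (#|D|.*2)%:R).
    apply: le_trans (_ : (\sum_i nb i)%:R <= _); last first.
      by rewrite ler_nat sum_neighbours ?discord_sub_pairs.
    rewrite natr_sum (bigID (mem bad)) /= mulr_natl -sumr_const.
    apply: ler_wpDr; first exact: sumr_ge0.
    by apply: ler_sum => i; rewrite inE => /ltW.
  have -> : g / 2 * s = 2 * threshold by rewrite /s /threshold; field; rewrite gt_eqF.
  by rewrite -muln2 natrM mulrC ltr_pM2l.
have ms : (1 + d)%:R * s = g / 4 by rewrite /s; field; rewrite gt_eqF.
have [||||I [IN Im Idis Is Ispan]] :=
    @exists_spanning_clique _ _ _ _ _ N bad dis s (ltW s_gt0) Nrob.
- by move=> i j; rewrite /dis /= (sqdistC (u i)) (sqdistC (v i)).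
- by move=> i; rewrite /dis /= !sqdistxx eqxx.
- move=> i; rewrite !inE -leNgt => /andP[nbi iN].
  by rewrite dis_nb.
- by rewrite ms; move: bad_small g_gt0; lra.
have [|phi phi_iso phiI] := @exists_isometry _ _ _ u v (enum I).
  by move=> i j; rewrite !mem_enum => iI jI; apply/eqP/negPn/Idis.
exists phi => //; rewrite -ms.
have sub : [set i in N | phi (u i) != v i] \subset
    \bigcup_(k in I) [set j in N | dis k j].
  apply/fintype.subsetP => i; rewrite inE => /andP[iN]; apply: contraR => inear.
  rewrite -sqdist_eq0; have [c cP] := exists_bisector (phi (u i)) (v i).
  rewrite -[0](sqdistxx (v i)) -cP; apply/eqP/Ispan => // k kI; apply/eqP.
  rewrite cP -{1}(phiI k) ?mem_enum // phi_iso.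
  apply: contraR inear => dki; apply/finset.bigcupP; exists k => //.
  by rewrite inE iN /dis /= (sqdistC (u k)) (sqdistC (v k)).
apply: le_trans (_ : #|\bigcup_(k in I) [set j in N | dis k j]|%:R <= _).
  by rewrite ler_nat subset_leq_card.
by apply: card_bigcup_le => //; apply: ltW.
Qed.

(** For [i] in [B], the bisector of [w i] and [v i] does not contain [v i], so
    it misses at least [g] points of [N]. At least [g / 2] of these lie outside
    [B], where [w] and [v] coincide, and each is in discord with [i]. *)
Lemma large_displacement w B : B \subset N ->
  (forall i, i \in N -> (w i != v i) = (i \in B)) ->
  g / 4 < #|B|%:R -> #|B|%:R <= g / 2 ->
  threshold <= #|discord v N w B|%:R.
Proof.
move=> BN wB Blb Bub; set D := discord _ _ _ _.
have nb_lb i : i \in B -> g / 2 <= #|[set j | [set i; j] \in D]|%:R.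
  move=> iB; have iN := fintype.subsetP BN i iB.
  have [c cP] := exists_bisector (w i) (v i).
  have [Nc|] := Nrob c.
    have /eqP := Nc i iN; rewrite cP sqdistxx sqdist_eq0 => /eqP wv.
    by move: (wB i iN); rewrite wv eqxx iB.
  set H := [set j in N | _] => Hg.
  have sub : H \subset B :|: [set j | [set i; j] \in D].
    apply/fintype.subsetP => j; rewrite inE cP => /andP[jN dij].
    rewrite finset.in_setU [X in _ || X]inE /D discord_pair iN jN iB /=.
    have [//|jB] := boolP (j \in B); rewrite /=.
    by have /negbT/negPn/eqP -> : (w j != v j) = false by rewrite wB // (negbTE jB).
  have : #|H|%:R <= #|B|%:R + #|[set j | [set i; j] \in D]|%:R :> R.
    rewrite -natrD ler_nat; apply: leq_trans (subset_leq_card sub) _.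
    by rewrite cardsU leq_subr.
  lra.
have Dlb : #|B|%:R * (g / 2) <= 2 * #|D|%:R.
  apply: (@le_trans _ _ (\sum_(i in B) #|[set j | [set i; j] \in D]|%:R)).
    by rewrite mulr_natl -sumr_const; apply: ler_sum.
  rewrite -natrM mul2n -natr_sum ler_nat.
  apply: leq_trans (sum_neighbours (discord_sub_pairs w B)).
  by rewrite [leqRHS](bigID (mem B)) /= leq_addr.
have : threshold <= g ^+ 2 / 16.
  rewrite /threshold ler_pM2l ?exprn_gt0 // lef_pV2 ?posrE ?mulr_gt0 ?ltr0n //.
  by rewrite ler_peMr // ler1n.
have : g / 4 * (g / 2) <= #|B|%:R * (g / 2) by rewrite ler_pM2r ?ltW // divr_gt0.
rewrite expr2; lra.
Qed.

(** The sets [B] displaced by configurations that explain [G] except inside [B]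
    absorb the set displaced by any explaining configuration, as long as they
    have size at most [g / 4]: the union has size at most [g / 2], and
    [large_displacement] forbids sizes above [g / 4]. *)
Lemma exists_reconstructable G : 
  (forall u B, threshold <= #|discord v N u B|%:R ->
     ~~ [disjoint discord v N u B & G]) ->
  exists2 A, reconstructable G v A & #|N|%:R - g / 4 <= #|A|%:R.
Proof.
move=> hit.
pose P (B : {set 'I_n}) := (B \subset N) /\ exists2 w,
  forall i, i \in N -> (w i != v i) = (i \in B) & [disjoint discord v N w B & G].
pose small (B : {set 'I_n}) := `[< P B >] && (#|B|%:R <= g / 4).
have P0 : small finset.set0.
  rewrite /small cards0 ltW ?divr_gt0 // andbT; apply/asboolP; split.
    exact: finset.sub0set.
  exists v => [i _|]; first by rewrite inE eqxx.
  apply/pred0P => e /=; apply/negbTE/negP => /andP[eD].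
  have [i [j ee]] := discord_pairP eD.
  by move: eD; rewrite ee discord_pair eqxx !andbF.
case: (@arg_maxnP _ finset.set0 small (fun B => #|B|) P0) => B.
move=> /andP[/asboolP[BN [w wB wG]] Bg] Bmax.
exists (N :\: B); last first.
  rewrite cardsDS // natrB ?subset_leq_card // lerD2l lerN2; exact: Bg.
move=> u _ uG.
have uG' (phi : 'rV_d -> 'rV_d) i j : isometry phi -> [set i; j] \in G ->
    sqdist (phi (u i)) (phi (u j)) = sqdist (v i) (v j).
  by move=> phi_iso /uG/eucl_dist_eq; rewrite phi_iso.
have [|phi phi_iso] := @small_displacement u.
  rewrite ltNge; apply/negP => /hit/negP[]; apply/pred0P => e /=.
  apply/negbTE/negP => /andP[eD eG]; have [i [j ee]] := discord_pairP eD.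
  move: eD eG; rewrite ee discord_pair => /and4P[_ _ _ /eqP neq].
  by move=> /(uG' id i j (fun _ _ => erefl)).
set C := [set i in N | _] => Cg.
have phi_fix i : i \in N -> i \notin C -> phi (u i) = v i.
  by move=> iN; rewrite inE iN /= negbK => /eqP.
(* Off [B] the values of [w] are those of [v] and can be replaced freely. *)
pose w' i := if i \in B then w i else phi (u i).
have PBC : P (B :|: C).
  split.
    rewrite finset.subUset BN.
    by apply/fintype.subsetP => i; rewrite inE => /andP[].
  exists w' => [i iN|].
    by rewrite /w' !inE iN /=; case: ifP => // iB; rewrite wB.
  apply/pred0P => e /=; apply/negbTE/negP => /andP[eD eG].
  have [i [j ee]] := discord_pairP eD; move: eD eG; rewrite ee discord_pair /w'.
  move=> /and4P[iN jN notBC] + eG.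
  (* Here [l] is displaced by neither configuration. *)
  have mixed k l : k \in N -> l \in N -> k \in B -> l \notin B -> [set k; l] \in G ->
      ~~ ((k \in B :|: C) && (l \in B :|: C)) ->
      sqdist (w k) (phi (u l)) = sqdist (v k) (v l).
    move=> kN lN kB lB klG; rewrite !inE kB (negbTE lB) /= => lC.
    rewrite phi_fix ?inE //.
    have wl : w l = v l by apply/eqP/negPn; rewrite wB.
    apply/eqP; apply: contraTT wG => neq; apply/pred0Pn; exists [set k; l] => /=.
    by rewrite klG andbT discord_pair kN lN kB (negbTE lB) /= wl.
  case: ifP => iB; case: ifP => jB.
  - by move: notBC; rewrite !inE iB jB.
  - by rewrite (mixed i j) ?jB // eqxx.
  - rewrite sqdistC (sqdistC (v i)) (mixed j i) ?iB ?eqxx //.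
      by rewrite finset.setUC.
    by rewrite andbC.
  - by rewrite (uG' phi) // eqxx.
have BCg : #|B :|: C|%:R <= g / 4.
  rewrite leNgt; apply/negP => BCg.
  have [BCN [w2 w2B w2G]] := PBC.
  have /hit : threshold <= #|discord v N w2 (B :|: C)|%:R.
    apply: large_displacement => //.
    have : #|B :|: C|%:R <= #|B|%:R + #|C|%:R :> R.
      by rewrite -natrD ler_nat cardsU leq_subr.
    move: Bg Cg; rewrite -/C; lra.
  by rewrite w2G.
have CB : C \subset B.
  have /Bmax BC : small (B :|: C) by apply/andP; split => //; apply/asboolP.
  have /eqP -> : B == B :|: C by rewrite eqEcard finset.subsetUl.
  exact: finset.subsetUr.
move=> i j; rewrite !inE => /andP[iB iN] /andP[jB jN] _; apply/eucl_dist_eq.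
rewrite -phi_iso !phi_fix //; [apply: contra jB | apply: contra iB];
exact: (fintype.subsetP CB).
Qed.

End Combination.

(** * Random graphs *)
Section RandomGraph.
Variables (R : realType) (n : nat) (p : R).
Hypothesis p01 : 0 <= p <= 1.
Implicit Types E : {set {set 'I_n}} -> Prop.

Lemma gnp_prob_ge0 E : 0 <= gnp_prob p E.
Proof. by apply: sumr_ge0 => G _; apply: subset_weight_ge0. Qed.

Lemma gnp_prob_complement (E E' : {set {set 'I_n}} -> Prop) :
  (forall G : {set {set 'I_n}}, G \subset vpairs n -> ~ E G -> E' G) ->
  1 - gnp_prob p E' <= gnp_prob p E.
Proof.
move=> EE'; rewrite lerBlDr -(sum_subset_weight (vpairs n) p).
rewrite (bigID (fun G => `[< E G >])) /= lerD2l.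
rewrite big_mkcondr [leRHS]big_mkcondr /=.
apply: ler_sum => G; rewrite inE => GX.
have w0 := subset_weight_ge0 (vpairs n) p01 G.
case: asboolP => [_|/(EE' _ GX) E'G] /=; first by case: ifP.
by rewrite asboolT.
Qed.

Lemma card_vpairs_le : (#|vpairs n| <= n ^ 2)%N.
Proof.
have -> : #|vpairs n| = 'C(#|'I_n|, 2) by rewrite -card_draws.
rewrite card_ord bin2 -mulnn.
apply: leq_trans (half_leq (leq_mul (leqnn n) (leq_pred n))) _.
by rewrite leq_half_double -addnn leqW // leq_addr.
Qed.

Lemma gnp_prob_card (a : R) : 0 < a ->
  gnp_prob p (fun G : {set {set 'I_n}} => a < #|G|%:R) <= p * (n ^ 2)%:R / a.
Proof.
move=> a0; rewrite ler_pdivlMr //.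
apply: (@le_trans _ _ (p * #|vpairs n|%:R)); last first.
  by rewrite ler_wpM2l ?ler_nat ?card_vpairs_le //; case/andP: p01.
rewrite -sum_subset_weight_card mulr_suml [leLHS]big_mkcondr /=.
apply: ler_sum => G _; have w0 := subset_weight_ge0 (vpairs n) p01 G.
case: asboolP => [aG|_]; last exact: mulr_ge0.
by rewrite ler_wpM2l // ltW.
Qed.

End RandomGraph.

Lemma exists_root (R : realType) (k : nat) (y : R) : (0 < k)%N -> 0 < y ->
  exists2 h, 0 < h & (1 + h) ^+ k = 1 + y.
Proof.
move=> k0 y0; have k0' : (k%:R : R) != 0 by rewrite pnatr_eq0 -lt0n.
pose l := (1 + y) `^ k%:R^-1.
have lk : l ^+ k = 1 + y.
  rewrite -powR_mulrn ?powR_ge0 // -powRrM mulVf // powRr1 //.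
  by rewrite addr_ge0 // ltW.
have l1 : 1 < l.
  rewrite ltNge; apply/negP => l1.
  have : l ^+ k <= 1 by rewrite exprn_ile1 // powR_ge0.
  by rewrite lk gerDl leNgt y0.
by exists (l - 1); rewrite ?subr_gt0 // addrC subrK.
Qed.

(** With [eps * n ^ 2] the threshold on discords, the number of
    traces is allowed to grow like [(1 + eps / 2) ^ #|S|]. The probability that
    a large discord set misses the graph is then at most
    [(C * exp (- eps / 2 * p * n)) ^ n], and [x0] makes the base at most
    [eta]. *)
Lemma most_reconstructable (R : realType) (d : nat) (eta : R) :
  (0 < d)%N -> 0 < eta <= 1 ->
  exists x0 : R, forall (n : nat) (p : R) (v : 'I_n -> 'rV[R]_d),
    0 <= p <= 1 -> (0 < n)%N -> x0 <= p * n%:R ->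
    1 - eta <= gnp_prob p (fun G : {set {set 'I_n}} => exists2 A : {set 'I_n},
      reconstructable G v A & (1 - eta) * n%:R <= #|A|%:R).
Proof.
move=> d0 /andP[eta0 eta1].
have m0 : 0 < (1 + d)%:R :> R by rewrite ltr0n.
have m1 : 0 < (2 + d)%:R :> R by rewrite ltr0n.
pose eps : R := (eta / (2 + d)%:R) ^+ 2 / (16 * (1 + d)%:R).
have eps0 : 0 < eps by rewrite divr_gt0 ?exprn_gt0 ?mulr_gt0 ?divr_gt0.
have [h h0 hE] : exists2 h, 0 < h & (1 + h) ^+ d.*2 = 1 + eps / 2.
  by apply: exists_root; rewrite ?double_gt0 // divr_gt0.
pose C : R := 2 * (1 + 2 / h) ^+ d.
have C0 : 0 < C by rewrite mulr_gt0 // exprn_gt0 // addr_gt0 // divr_gt0.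
exists (2 * C / (eta * eps)) => n p v p01 n0 x0.
have [p0 p1] := andP p01.
have nR0 : 0 < n%:R :> R by rewrite ltr0n.
pose g := eta * n%:R / (2 + d)%:R.
have g0 : 0 < g by rewrite divr_gt0 // mulr_gt0.
have [N Nn Nrob] := exists_robust (fun i => homog (v i)) (ltW g0).
have thresholdE : threshold d g = eps * n%:R ^+ 2.
  by rewrite /threshold /eps /g; field; rewrite !gt_eqF.
pose fam (D : {set {set 'I_n}}) := exists u B,
  D = discord v N u B /\ threshold d g <= #|D|%:R.
pose bad (G : {set {set 'I_n}}) :=
  exists2 D : {set {set 'I_n}}, fam D & [disjoint D & G].
apply: le_trans (_ : 1 - gnp_prob p bad <= _); last first.
  apply: (gnp_prob_complement p01) => G _ noA; apply: contrapT => Gok; apply: noA.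
  have [|A GA Ag] := exists_reconstructable g0 Nrob (G := G).
    move=> u B uB; apply/negP => DG; apply: Gok.
    by exists (discord v N u B) => //; exists u, B.
  exists A => //; apply: le_trans Ag; move: Nn.
  rewrite mulrBl mul1r.
  have -> : eta * n%:R = g * (1 + d)%:R + g.
    rewrite /g -[(2 + d)%N]/(1 + (1 + d))%N natrD; field.
    by rewrite gt_eqF // addr_gt0.
  by move: g0; lra.
rewrite lerD2l lerN2.
pose c := expR (- (p * (eps * n%:R ^+ 2))).
have expr_le k : (1 - p) ^+ k <= expR (- (p * k%:R)).
  rewrite -mulNr expRM_natr.
  apply: lerXn2r; rewrite ?nnegrE ?expR_ge0 ?subr_ge0 //.
  by apply: le_trans (expR_ge1Dx _); rewrite addrC.
have famP (D : {set {set 'I_n}}) : fam D -> D \subset vpairs n /\ (1 - p) ^+ #|D| <= c.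
  move=> [u [B [-> tD]]]; split; first exact: discord_sub_pairs.
  apply: le_trans (expr_le _) _; rewrite ler_expR lerN2 ler_wpM2l //.
  by rewrite -thresholdE.
have tauP (S : {set {set 'I_n}}) : S \subset vpairs n ->
    #|[set H : {set {set 'I_n}} |
        `[< exists2 D : {set {set 'I_n}}, fam D & H = D :&: S >]]|%:R
    <= C ^+ n * (1 + eps / 2) ^+ #|S|.
  move=> Spairs; rewrite -hE; apply: (card_discord_traces (v := v) (N := N)) => //.
  by move=> D [u [B [-> _]]]; exists u, B.
apply: le_trans (subset_weight_avoid p01 (expR_ge0 _) famP tauP) _.
under eq_bigr => S _ do rewrite mulrCA.
rewrite -mulr_sumr (sum_subset_weight_exp (vpairs n) p).
rewrite [1 + eps / 2 - 1]addrAC subrr add0r.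
have step : (1 + p * (eps / 2)) ^+ #|vpairs n| <= expR (p * (eps / 2) * n%:R ^+ 2).
  apply: (@le_trans _ _ (expR (p * (eps / 2)) ^+ #|vpairs n|)).
    apply: lerXn2r; rewrite ?nnegrE ?expR_ge0 ?expR_ge1Dx //.
    by rewrite addr_ge0 // mulr_ge0 // ltW // divr_gt0.
  rewrite -expRM_natr ler_expR ler_wpM2l //.
    by rewrite mulr_ge0 // ltW // divr_gt0.
  by rewrite -natrX ler_nat card_vpairs_le.
apply: (@le_trans _ _ ((C * expR (- (eps / 2 * (p * n%:R)))) ^+ n)).
  rewrite [leRHS]exprMn -[X in _ <= _ * X]expRM_natr mulrCA.
  rewrite ler_wpM2l ?exprn_ge0 ?(ltW C0) //.
  apply: le_trans (ler_wpM2l (expR_ge0 _) step) _.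
  rewrite -expRD ler_expR le_eqVlt; apply/orP; left; apply/eqP.
  by field.
have Ce : C * expR (- (eps / 2 * (p * n%:R))) <= eta.
  rewrite expRN ler_pdivrMr ?expR_gt0 //.
  apply: le_trans (ler_wpM2l (ltW eta0) (expR_ge1Dx _)).
  move: x0; rewrite ler_pdivrMr ?mulr_gt0 // => x0.
  rewrite mulrDr mulr1; apply: ler_wpDl; first exact: ltW.
  have -> : eta * (eps / 2 * (p * n%:R)) = p * n%:R * (eta * eps) / 2 by field.
  by rewrite ler_pdivlMr // mulrC.
have Ce0 : 0 <= C * expR (- (eps / 2 * (p * n%:R))).
  by rewrite mulr_ge0 ?expR_ge0 // ltW.
apply: (le_trans _ Ce); apply: ler_iXnr => //.
exact: le_trans Ce eta1.
Qed.

Lemma reconstructable_no_isolated (R : realType) (d n : nat)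
    (v : 'I_n -> 'rV[R]_d) (G : {set {set 'I_n}}) (A : {set 'I_n}) :
  (0 < d)%N -> injective v -> reconstructable G v A -> (1 < #|A|)%N ->
  A \subset finset.cover G.
Proof.
case: d v => // d v _ vinj GA A1; apply/fintype.subsetP => i iA.
apply: contraT => iG.
have /card_gt0P[j] : (0 < #|A :\ i|)%N.
  by move: A1; rewrite (cardsD1 i) iA add1n ltnS.
rewrite !inE => /andP[ji jA].
(* The first coordinate of the new position alone puts vertex [i] too far away
   from vertex [j], and apart from all other vertices. *)
pose far : R := \sum_l `|v l 0 0| + eucl_dist (v i) (v j) + 1.
have dist_ge0 x y : 0 <= eucl_dist x y :> R by apply: sqrtr_ge0.
have farP l : eucl_dist (v i) (v j) < far - v l 0 0.
  have : v l 0 0 <= \sum_l `|v l 0 0|.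
    apply: le_trans (ler_norm _) _.
    by rewrite (bigD1 l) //= lerDl sumr_ge0.
  rewrite /far; lra.
pose u l : 'rV[R]_d.+1 := if l == i then const_mx far else v l.
have u_neq l : l != i -> u l != u i.
  rewrite /u eqxx => /negbTE ->; apply/eqP => /rowP/(_ 0); rewrite mxE => vl.
  by have := farP l; rewrite vl subrr ltNge dist_ge0.
have uinj : injective u.
  move=> k l ukl; have [ki|ki] := eqVneq k i.
    have [->//|/u_neq] := eqVneq l i; by rewrite -ukl ki eqxx.
  have [li|li] := eqVneq l i; first by move: (u_neq k ki); rewrite ukl li eqxx.
  by apply: vinj; move: ukl; rewrite /u (negbTE ki) (negbTE li).
have uG k l : [set k; l] \in G -> eucl_dist (u k) (u l) = eucl_dist (v k) (v l).
  move=> klG; rewrite /u.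
  have inG x : x \in [set k; l] -> x == i = false.
    by move=> xkl; apply: contraNF iG => /eqP <-; apply/finset.bigcupP; exists [set k; l].
  by rewrite !inG ?inE ?eqxx ?orbT.
have := GA u uinj uG i j iA jA; rewrite eq_sym => /(_ ji) uvij.
suff : eucl_dist (v i) (v j) < eucl_dist (u i) (u j) by rewrite uvij ltxx.
apply: lt_le_trans (farP j) _; apply: le_trans (ler_norm _) _.
rewrite -sqrtr_sqr ler_wsqrtr // /u eqxx (negbTE ji).
rewrite big_ord_recl mxE lerDl sumr_ge0 // => k _; exact: sqr_ge0.
Qed.

(** A reconstructable set of size above [eta * n] has at least two elements, as
    [eta * n] is at least 2, so it is covered by the edges and there are more
    than [eta * n / 4] of them. *)
Lemma few_reconstructable (R : realType) (d n : nat) (eta p : R)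
    (v : 'I_n -> 'rV[R]_d) :
  (0 < d)%N -> injective v -> 0 <= p <= 1 -> 0 < eta ->
  2 <= eta * n%:R -> p * n%:R <= eta ^+ 2 / 4 ->
  1 - eta <= gnp_prob p (fun G : {set {set 'I_n}} =>
    forall A : {set 'I_n}, reconstructable G v A -> #|A|%:R <= eta * n%:R).
Proof.
move=> d0 vinj p01 eta0 n2 pn.
pose a := eta * n%:R / 4.
have a0 : 0 < a by rewrite divr_gt0 //; apply: lt_le_trans n2.
pose many (G : {set {set 'I_n}}) : Prop := a < #|G|%:R.
apply: le_trans (gnp_prob_complement (E' := many) p01 _); last first.
  move=> G GX nsmall; rewrite /many ltNge; apply/negP => Ga; apply: nsmall => A GA.
  have [A1|/(reconstructable_no_isolated d0 vinj GA) AG] := leqP #|A| 1.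
    by move: A1; rewrite -(ler_nat R); lra.
  have : (#|A| <= #|G|.*2)%N.
    apply: leq_trans (subset_leq_card AG) (leq_trans (leq_of_leqif (leq_card_cover G)) _).
    rewrite -muln2 -sum_nat_const; apply/eq_leq/eq_bigr => e /(fintype.subsetP GX).
    by rewrite inE => /eqP.
  rewrite -(ler_nat R) -muln2 natrM; move: Ga; rewrite /a; lra.
rewrite lerD2l lerN2; apply: le_trans (gnp_prob_card n p01 a0) _.
have n0 : 0 < n%:R :> R.
  by rewrite ltr0n lt0n; apply: contraTneq n2 => ->; rewrite mulr0 -ltNge.
rewrite ler_pdivrMr // natrX /a.
have -> : p * n%:R ^+ 2 = p * n%:R * n%:R by ring.
have -> : eta * (eta * n%:R / 4) = eta ^+ 2 / 4 * n%:R by ring.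
by rewrite ler_pM2r.
Qed.

Local Open Scope classical_set_scope.

(** Diagonal argument: for each [n] take the largest [k <= n] such that the
    error [1 / k.+1] is admissible. *)
Lemma exists_vanishing_rate (R : realType) (Q : R -> nat -> Prop) :
  (forall n, Q 1 n) ->
  (forall eta, 0 < eta <= 1 -> \forall n \near \oo, Q eta n) ->
  exists2 e : nat -> R, e @ \oo --> (0 : R) & forall n, Q (e n) n.
Proof.
move=> Q1 Qnear.
have best n : exists k : nat, Q k.+1%:R^-1 n /\
    forall i, (i <= n)%N -> Q i.+1%:R^-1 n -> (i <= k)%N.
  pose P (i : 'I_n.+1) := `[< Q i.+1%:R^-1 n >].
  have P0 : P ord0 by apply/asboolP; rewrite invr1.
  case: (@arg_maxnP _ ord0 P (fun i => i : nat) P0) => k /asboolP Qk kmax.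
  exists k; split=> // i; rewrite -ltnS => i_lt Qi.
  by apply: (kmax (Ordinal i_lt)); apply/asboolP.
have [k kP] := boolp.choice best.
exists (fun n => (k n).+1%:R^-1) => [|n]; last by have [] := kP n.
apply/cvgr0Pnorm_le => eps eps0.
have [i ieps] : exists i : nat, i.+1%:R^-1 <= eps.
  exists (Num.truncn eps^-1).
  rewrite invf_ple ?posrE //; exact/ltW/truncnS_gt.
have i1 : 0 < (i.+1%:R^-1 : R) <= 1.
  by rewrite invr_gt0 ltr0n /= invf_le1 ?ltr0n // ler1n.
near=> n; rewrite ger0_norm ?invr_ge0 //; apply: le_trans ieps.
rewrite lef_pV2 ?posrE // ler_nat ltnS; apply: (kP n).2.
  by near: n; exact: nbhs_infty_ge.
by near: n; apply: Qnear.
Unshelve. all: by end_near. Qed.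

Theorem theorem4 (R : realType) (d : nat) (hd : (1 <= d)%N) (p : nat -> R)
    (hp : forall n : nat, 0 <= p n <= 1) :
  ((fun n : nat => p n * n%:R) @ \oo --> +oo ->
   exists eps delta : nat -> R,
     [/\ eps @ \oo --> (0 : R),
         delta @ \oo --> (0 : R)
       & forall (n : nat) (v : 'I_n -> 'rV[R]_d), injective v ->
           1 - delta n <= gnp_prob (p n) (fun G : {set {set 'I_n}} =>
             exists2 A : {set 'I_n}, reconstructable G v A &
               (1 - eps n) * n%:R <= #|A|%:R)])
  /\
  ((fun n : nat => p n * n%:R) @ \oo --> (0 : R) ->
   exists eps delta : nat -> R,
     [/\ eps @ \oo --> (0 : R),
         delta @ \oo --> (0 : R)
       & forall (n : nat) (v : 'I_n -> 'rV[R]_d), injective v ->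
           1 - delta n <= gnp_prob (p n) (fun G : {set {set 'I_n}} =>
             forall A : {set 'I_n}, reconstructable G v A ->
               #|A|%:R <= eps n * n%:R)]).
Proof.
split=> pn.
  pose Q (eta : R) (n : nat) := forall v : 'I_n -> 'rV[R]_d, injective v ->
    1 - eta <= gnp_prob (p n) (fun G : {set {set 'I_n}} =>
      exists2 A : {set 'I_n}, reconstructable G v A &
        (1 - eta) * n%:R <= #|A|%:R).
  have [|eta eta01|e e0 eQ] := @exists_vanishing_rate R Q.
  - by move=> n v _; rewrite subrr; apply: gnp_prob_ge0.
  - have [x0 x0P] := @most_reconstructable R d eta hd eta01.
    have /cvgryPge/(_ x0) pn_ge := pn.
    near=> n => v _; apply: x0P => //; first by near: n; exact: nbhs_infty_gt.
    by near: n.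
  by exists e, e; split.
pose Q (eta : R) (n : nat) := forall v : 'I_n -> 'rV[R]_d, injective v ->
  1 - eta <= gnp_prob (p n) (fun G : {set {set 'I_n}} =>
    forall A : {set 'I_n}, reconstructable G v A -> #|A|%:R <= eta * n%:R).
have [|eta /andP[eta0 eta1]|e e0 eQ] := @exists_vanishing_rate R Q.
- by move=> n v _; rewrite subrr; apply: gnp_prob_ge0.
- have eta2 : 0 < eta ^+ 2 / 4 by rewrite divr_gt0 // exprn_gt0.
  have /cvgr0Pnorm_le/(_ _ eta2) pn_le := pn.
  near=> n => v vinj; apply: few_reconstructable => //.
    rewrite mulrC -ler_pdivrMr //; near: n; exact: nbhs_infty_ger.
  by apply: le_trans (ler_norm _) _; near: n.
by exists e, e; split.
Unshelve. all: by end_near. Qed.
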